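(* Let $\mathfrak{n}>\mathfrak{m}\ge2$ be integers and let $\Sigma\subseteq\Delta_{\mathfrak{m},\mathfrak{n}}^{\mathbb{N}}$ be a (nonempty) sofic subshift. Let $G$ be a finite labelled directed graph presenting $\Sigma$, with irreducible components $\{G_1,\ldots,G_k\}$. Suppose that either: (a) for some $1\le i\le k$, $G_i$ is a source and $h(\Sigma_{G_i})=h(\Sigma)$; or (b) for some $1\le i\le k$, $G_i$ is a sink and $h(\pi\Sigma_{G_i})=h(\pi\Sigma)$. Then the box dimension of $\Pi(\Sigma)$ exists and $$\dim_{\mathrm{B}}\Pi(\Sigma)=\frac{h(\pi\Sigma)}{\log\mathfrak{m}}+\frac{h(\Sigma)-h(\pi\Sigma)}{\log\mathfrak{n}}.$$
   Context: Let $\mathfrak{n}>\mathfrak{m}\ge2$ be integers and $\Delta_{\mathfrak{m},\mathfrak{n}}=\{(a,b): 1\le a\le\mathfrak{m},\ 1\le b\le\mathfrak{n},\ a,b\in\mathbb{N}\}$. For $(a,b)\in\Delta_{\mathfrak{m},\mathfrak{n}}$ let $S_{(a,b)}:[0,1]^2\to[0,1]^2$, $S_{(a,b)}(x,y)=\left(\frac{x+a-1}{\mathfrak{m}},\frac{y+b-1}{\mathfrak{n}}\right)$. The coding map $\Pi:\Delta_{\mathfrak{m},\mathfrak{n}}^{\mathbb{N}}\to[0,1]^2$ is $\Pi((a_1,b_1)(a_2,b_2)\ldots)=\lim_{n\to\infty}S_{(a_1,b_1)}\circ\cdots\circ S_{(a_n,b_n)}(0)$. A subshift is a compact set $\Sigma$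 of sequences over a finite alphabet (here a digit set $\mathcal{I}\subseteq\Delta_{\mathfrak{m},\mathfrak{n}}$) with $\sigma(\Sigma)\subseteq\Sigma$, where $\sigma$ is the left shift. $\Sigma_n$ denotes the set of words of length $n$ appearing in sequences of $\Sigma$, and the topological entropy is $h(\Sigma)=\lim_{n\to\infty}\frac1n\log\#\Sigma_n$. The projection $\pi$ is $\pi((a_1,b_1)(a_2,b_2)\ldots)=a_1a_2\ldots$; $\pi\Sigma$ is again a subshift. For bounded $E$, $N_\delta(E)$ is the smallest number of sets of diameter $\delta$ needed to cover $E$; $\underline{\dim}_{\mathrm{B}}E$ and $\overline{\dim}_{\mathrm{B}}E$ are the lower and upper limits as $\delta\to0$ of $\log N_\delta(E)/(-\log\delta)$, and $\dim_{\mathrm{B}}E$ is their common value when they coincide. A finite labelled directed graph $G$ (finite vertex set, finite edge set, each edge $e$ carrying a label $\ell(e)\in\mathcal{I}$) presents $\Sigma$ if $\Sigma$ is the set of all sequences $\ell(e_1)\ell(e_2)\ldots$ where $e_1e_2\ldots$ is an infinite path in $G$; $\Sigma$ is sofic if it is presented by such a graph. A graph is irreducible if for any pair of vertices $v,w$ there is a path from $v$ to $w$. The irreducible components $G_1,\ldots,G_k$ of $G$ are its maximal irreducible subgraphs. $\Sigma_{G_i}\subseteq\Sigma$ is the subshift of label sequences of infinite paths in $G_i$ (if $G_i$ is a single vertex without edges, its entropies are taken to be $0$). $\{i\}^+$ (resp. $\{i\}^-$) is the set of all $j\in\{1,\ldots,k\}$ such that there is a path in $G$ from a vertex of $G_i$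 to a vertex of $G_j$ (resp. from a vertex of $G_j$ to a vertex of $G_i$); always $i\in\{i\}^+\cap\{i\}^-$. $G_i$ is a source if $\{i\}^+=\{1,\ldots,k\}$ and a sink if $\{i\}^-=\{1,\ldots,k\}$. *)

(* Defs.v *)
From HB Require Import structures.
From mathcomp Require Import all_boot all_order all_algebra.
From mathcomp Require Import all_classical all_reals all_analysis.

Set Implicit Arguments.
Unset Strict Implicit.
Unset Printing Implicit Defensive.

Import Order.TTheory GRing.Theory Num.Theory.
Import numFieldNormedType.Exports.

Local Open Scope classical_set_scope.
Local Open Scope ring_scope.

(** * Subshifts and entropy *)

Definition shift (A : Type) (x : nat -> A) : nat -> A := fun i => x i.+1.

(* Compactness is for the product topology on [A^nat], [A] being discrete. *)
Definition is_subshift (A : finType) (Sigma : set (nat -> A)) : Prop :=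
  compact (Sigma : set {ptws nat -> discrete_topology A}) /\
  @shift A @` Sigma `<=` Sigma.

(* The words of length [l] that occur, at any position, in a sequence of
   [Sigma]. *)
Definition words (A : finType) (Sigma : set (nat -> A)) (l : nat) :
    {set l.-tuple A} :=
  [set w : l.-tuple A |
    `[< exists2 x, Sigma x &
        exists k : nat, forall i : 'I_l, tnth w i = x (k + i)%N >]]%SET.

(* As [ln 0 = 0], the entropy of the empty subshift is [0]; this is the
   convention wanted for a component made of one vertex and no edge. *)
Definition entropy (R : realType) (A : finType) (Sigma : set (nat -> A)) : R :=
  limn (fun l : nat => l%:R^-1 * ln (#|words Sigma l|%:R : R)).

(** * Labelled directed graphs *)

(* Parallel edges and loops are allowed. *)
Record lgraph (A : Type) := LGraph {
  vertex : finType;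
  edge : finType;
  source : edge -> vertex;
  target : edge -> vertex;
  label : edge -> A
}.

(* The label sequences of the infinite paths with edges in [E]. *)
Definition label_sequences (A : Type) (G : lgraph A) (E : {set edge G}) :
    set (nat -> A) :=
  [set x | exists p : nat -> edge G,
     [/\ forall i, p i \in E,
         forall i, target (p i) = source (p i.+1) &
         forall i, x i = label (p i)]].

Definition presents (A : Type) (G : lgraph A) (Sigma : set (nat -> A)) : Prop :=
  Sigma = label_sequences [set: edge G]%SET.

Definition is_sofic (A : finType) (Sigma : set (nat -> A)) : Prop :=
  is_subshift Sigma /\ exists G : lgraph A, presents G Sigma.

(* Existence of a finite path with edges in [E]; the path of length zero from a
   vertex to itself is allowed. *)
Definition has_path (A : Type) (G : lgraph A) (E : {set edge G})
    (v w : vertex G) : bool :=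
  connect [rel u u' | [exists e in E, (source e == u) && (target e == u')]] v w.

(* A vertex set and an edge set; see [is_subgraph]. *)
Definition subgraph (A : Type) (G : lgraph A) : Type :=
  ({set vertex G} * {set edge G})%type.

Definition is_subgraph (A : Type) (G : lgraph A) (H : subgraph G) : Prop :=
  forall e, e \in H.2 -> source e \in H.1 /\ target e \in H.1.

Definition irreducible_subgraph (A : Type) (G : lgraph A) (H : subgraph G) :
    Prop :=
  [/\ is_subgraph H,
      exists v, v \in H.1 &
      forall v w, v \in H.1 -> w \in H.1 -> has_path H.2 v w].

Definition component (A : Type) (G : lgraph A) : set (subgraph G) :=
  [set H | irreducible_subgraph H /\
     forall H' : subgraph G, irreducible_subgraph H' ->
       H.1 \subset H'.1 -> H.2 \subset H'.2 -> H' = H].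

(* The subshift of the label sequences of the infinite paths in [H]. *)
Definition component_shift (A : Type) (G : lgraph A) (H : subgraph G) :
    set (nat -> A) :=
  label_sequences H.2.

Definition leads_to (A : Type) (G : lgraph A) (H K : subgraph G) : Prop :=
  exists v w, [/\ v \in H.1, w \in K.1 & has_path [set: edge G]%SET v w].

(* The sets $\{i\}^+$ and $\{i\}^-$. *)
Definition comps_after (A : Type) (G : lgraph A) (H : subgraph G) :
    set (subgraph G) :=
  [set K | component K /\ leads_to H K].

Definition comps_before (A : Type) (G : lgraph A) (H : subgraph G) :
    set (subgraph G) :=
  [set K | component K /\ leads_to K H].

Definition is_source (A : Type) (G : lgraph A) (H : subgraph G) : Prop :=
  comps_after H = @component A G.

Definition is_sink (A : Type) (G : lgraph A) (H : subgraph G) : Prop :=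
  comps_before H = @component A G.

(** * Coding by a planar grid *)

(* The ordinals are 0-based: [(i, j)] stands for the digit [(i + 1, j + 1)]. *)
Definition digit (m n : nat) : finType := ('I_m * 'I_n)%type.

Definition grid_map (R : realType) (m n : nat) (d : digit m n) (p : R * R) :
    R * R :=
  ((p.1 + (d.1.+1)%:R - 1) / m%:R, (p.2 + (d.2.+1)%:R - 1) / n%:R).

(* This is [limn], which the library does not offer on a product type. *)
Definition coding_map (R : realType) (m n : nat) (x : nat -> digit m n) :
    R * R :=
  [get z : R * R |
    (fun l : nat => foldr (@grid_map R m n) (0, 0) (mkseq x l)) @ \oo --> z].

(* The map $\pi$ on sequences. *)
Definition proj_seq (m n : nat) (x : nat -> digit m n) : nat -> 'I_m :=
  fun i => (x i).1.

(** * Box dimension in the plane *)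

Definition edist (R : realType) (p q : R * R) : R :=
  Num.sqrt ((p.1 - q.1) ^+ 2 + (p.2 - q.2) ^+ 2).

Definition diameter (R : realType) (U : set (R * R)) : \bar R :=
  ereal_sup [set (edist p q)%:E | p in U & q in U].

Definition coverable (R : realType) (E : set (R * R)) (delta : R) (N : nat) :
    Prop :=
  exists U : 'I_N -> set (R * R),
    (forall i, diameter (U i) = delta%:E) /\ E `<=` \bigcup_i U i.

(* The default value [0] is only taken when there is no finite cover, hence
   never for a bounded [E] and [0 < delta]. *)
Definition covering_number (R : realType) (E : set (R * R)) (delta : R) : nat :=
  xget 0%N [set N | coverable E delta N /\
                    forall M, coverable E delta M -> (N <= M)%N].

Definition box_ratio (R : realType) (E : set (R * R)) (delta : R) : \bar R :=
  (ln (covering_number E delta)%:R / - ln delta)%:E.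

Definition lower_box_dim (R : realType) (E : set (R * R)) : \bar R :=
  limf_einf (box_ratio E) 0^'+.

Definition upper_box_dim (R : realType) (E : set (R * R)) : \bar R :=
  limf_esup (box_ratio E) 0^'+.

(* The box dimension of [E] exists and is equal to [s]. *)
Definition has_box_dim (R : realType) (E : set (R * R)) (s : R) : Prop :=
  lower_box_dim E = s%:E /\ upper_box_dim E = s%:E.

(* Main.v *)
Require Import Defs.
From HB Require Import structures.
From mathcomp Require Import all_boot all_order all_algebra.
From mathcomp Require Import all_classical all_reals all_analysis.
From mathcomp Require Import ring lra zify.

Set Implicit Arguments.
Unset Strict Implicit.
Unset Printing Implicit Defensive.

Import Order.TTheory GRing.Theory Num.Theory.
Import numFieldNormedType.Exports.

Local Open Scope classical_set_scope.
Local Open Scope ring_scope.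

(** Write h for the entropy of Sigma, g for that of its projection pi Sigma,
    and fix a scale delta.  Let k and L be such that n^-k and m^-L are both
    comparable to delta; as m < n, we have k <= L.  Prescribing the first k
    digits (a_i, b_i) of a sequence and the next L - k first coordinates a_i
    confines its image to a rectangle of width m^-L and height n^-k, an
    approximate square.  Approximate squares with different codes overlap only
    boundedly often at scale delta, so the covering number of the coded set is,
    up to a constant factor, the number Q(k, L) of approximate squares that
    Sigma meets ([coverable_squares], [card_squares_le_cover]).

    For any subshift Q(k, L) is at most the number of words of length k of
    Sigma times the number of words of length L - k of pi Sigma
    ([card_squares_le]).  If this is also a lower bound up to subexponential
    factors, then

      log Q(k, L) = k h + (L - k) g + o(k + L),

    and dividing by - log delta, which is k log n and L log m up to bounded
    errors, gives g / log m + (h - g) / log n.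

    The hypothesis on the graph provides the lower bound.  Suppose that a source
    component carries the whole entropy h.  Each path in it can be followed,
    after a connecting path with at most as many edges as G has vertices, by any
    path of G; hence every word of the component can be continued by every word
    of pi Sigma, up to a gap of bounded length.  Counting such continuations
    ([card_linked_words]) bounds the product of the two numbers of words by a
    constant times Q(k, L), the constant accounting for the length of the gap
    and for the letters of pi Sigma pushed beyond position L.  The sink case is
    symmetric: all words of Sigma can be continued by the words of the
    projection of the component. *)

(** All the comparisons of cardinals below have this form: an element of [X] is
    encoded in [Y] by a choice of sequence or path that need not be canonical,
    but from which it can be read off. *)
Lemma card_le_rel (A B : finType) (X : {set A}) (Y : {set B})
    (S : A -> B -> Prop) :
  (forall a, a \in X -> exists2 b, b \in Y & S a b) ->
  (forall a a' b, S a b -> S a' b -> a = a') ->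
  (#|X| <= #|Y|)%N.
Proof.
move=> SX Sinj; have [->|[a0 a0X]] := set_0Vmem X; first by rewrite cards0.
have [b0 _ _] := SX _ a0X.
pose f a := xget b0 [set b | b \in Y /\ S a b].
have fP a : a \in X -> f a \in Y /\ S a (f a).
  move=> /SX[b bY Sab].
  exact: (@xgetPex _ b0 [set b | b \in Y /\ S a b])
    (ex_intro _ b (conj bY Sab)).
rewrite -(@card_in_imset _ _ f X).
  by apply/subset_leq_card/fintype.subsetP => _ /imsetP[a /fP[fY _] ->].
move=> a a' /fP[_ Sa] /fP[_ Sa'] eqf; apply: Sinj Sa _.
by rewrite eqf.
Qed.

(** * Words *)

Definition factor (A : Type) (x : nat -> A) (k l : nat) : seq A :=
  mkseq (fun i => x (k + i)%N) l.

Lemma size_factor A (x : nat -> A) k l : size (factor x k l) = l.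
Proof. exact: size_mkseq. Qed.

Lemma factorD A (x : nat -> A) k p q :
  factor x k (p + q) = factor x k p ++ factor x (k + p)%N q.
Proof.
rewrite /factor /mkseq iotaD map_cat; congr (_ ++ _).
rewrite add0n -[X in iota X q]addn0 iotaDl -map_comp; apply: eq_map => i /=.
by rewrite addnA.
Qed.

Lemma eq_factor A (x y : nat -> A) k k' l :
  (forall i, (i < l)%N -> x (k + i)%N = y (k' + i)%N) ->
  factor x k l = factor y k' l.
Proof. by move=> h; apply/eq_in_map => i; rewrite mem_iota => /andP[_ /h]. Qed.

Lemma map_factor A B (f : A -> B) (x : nat -> A) k l :
  map f (factor x k l) = factor (f \o x) k l.
Proof. by rewrite /factor /mkseq -map_comp. Qed.

Lemma wordsP (A : finType) (S : set (nat -> A)) l (w : l.-tuple A) :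
  reflect (exists2 x, S x & exists k, val w = factor x k l) (w \in words S l).
Proof.
rewrite inE; apply: (iffP (asboolP _)) => -[x Sx [k wk]]; exists x => //;
  exists k.
- apply: (@eq_from_nth _ (x 0%N)); rewrite ?size_tuple ?size_factor// => i il.
  by rewrite nth_mkseq// -(wk (Ordinal il)) (tnth_nth (x 0%N)).
- by move=> i; rewrite (tnth_nth (x 0%N)) wk nth_mkseq.
Qed.

Lemma tuple_of_size (A : Type) (s : seq A) l :
  size s = l -> {w : l.-tuple A | val w = s}.
Proof. by move=> /eqP sl; exists (Tuple sl). Qed.

(** Cutting a word in two is injective; both pieces occur in the same sequence,
    as occurrences at any position are counted. *)
Lemma card_wordsD (A : finType) (S : set (nat -> A)) p q :
  (#|words S (p + q)| <= #|words S p| * #|words S q|)%N.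
Proof.
rewrite -cardsX.
apply: (@card_le_rel _ _ _ _ (fun w ww => val w = val ww.1 ++ val ww.2)).
  move=> w /wordsP[x Sx [k wk]].
  have [w1 w1E] := tuple_of_size (size_factor x k p).
  have [w2 w2E] := tuple_of_size (size_factor x (k + p)%N q).
  exists (w1, w2); last by rewrite /= w1E w2E wk factorD.
  by rewrite inE; apply/andP; split; apply/wordsP; exists x => //;
    [exists k|exists (k + p)%N].
by move=> w w' ww ww1 ww2; apply: val_inj; rewrite /= ww1 ww2.
Qed.

Lemma card_words_gt0 (A : finType) (S : set (nat -> A)) l :
  S !=set0 -> (0 < #|words S l|)%N.
Proof.
move=> [x Sx]; apply/card_gt0P.
have [w wE] := tuple_of_size (size_factor x 0 l).
by exists w; apply/wordsP; exists x => //; exists 0%N.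
Qed.

Lemma words_set0 (A : finType) l :
  words (set0 : set (nat -> A)) l = finset.set0.
Proof.
by apply/setP => w; rewrite !inE; apply/negbTE/asboolPn => -[x []].
Qed.

Lemma card_words_sub (A : finType) (S T : set (nat -> A)) l :
  S `<=` T -> (#|words S l| <= #|words T l|)%N.
Proof.
move=> ST; apply/subset_leq_card/fintype.subsetP => w /wordsP[x /ST Tx xw].
by apply/wordsP; exists x.
Qed.

Definition shift_invariant (A : Type) (S : set (nat -> A)) :=
  forall x, S x -> S (Defs.shift x).

Lemma shift_invariant_iter A (S : set (nat -> A)) x k :
  shift_invariant S -> S x -> S (fun i => x (k + i)%N).
Proof.
move=> inv; elim: k x => [//|k IH] x Sx.
rewrite (_ : (fun i => _) = (fun i => (Defs.shift x) (k + i)%N)).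
  exact/IH/inv.
by apply/funext => i; rewrite /Defs.shift.
Qed.

(** * Approximate squares *)

Section approximate_squares.
Context (m n : nat).
Implicit Types (S : set (nat -> digit m n)) (x : nat -> digit m n).
Local Notation proj := (@proj_seq m n).

(** The first [k] coordinates [a_i] are recorded in both parts of the code, so
    that each part is a plain prefix. *)
Definition square_code (k L : nat) x
    (c : k.-tuple (digit m n) * L.-tuple 'I_m) : Prop :=
  val c.1 = factor x 0 k /\ val c.2 = factor (proj x) 0 L.

Definition squares S (k L : nat) :=
  [set c : k.-tuple (digit m n) * L.-tuple 'I_m |
    `[< exists2 x, S x & square_code x c >]]%SET.

Lemma squaresP S k L c :
  reflect (exists2 x, S x & square_code x c) (c \in squares S k L).
Proof. by rewrite inE; exact: asboolP. Qed.

Lemma square_codeE k L x : exists c, @square_code k L x c.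
Proof.
have [w wE] := tuple_of_size (size_factor x 0 k).
have [u uE] := tuple_of_size (size_factor (proj x) 0 L).
by exists (w, u).
Qed.

Lemma pair_val_inj (A B : finType) k L (c c' : k.-tuple A * L.-tuple B) :
  val c.1 = val c'.1 -> val c.2 = val c'.2 -> c = c'.
Proof. by case: c c' => [a b] [a' b'] /= /val_inj-> /val_inj->. Qed.

(** The upper bound: the code of [x] consists of a word of [S] and of the
    projected word that follows it. *)
Lemma card_squares_le S k L : (k <= L)%N ->
  (#|squares S k L| <= #|words S k| * #|words (proj @` S) (L - k)|)%N.
Proof.
move=> kL; rewrite -cardsX.
apply: (@card_le_rel _ _ _ _ (fun c ww => val c.1 = val ww.1 /\
  val c.2 = map fst (val ww.1) ++ val ww.2)).
  move=> c /squaresP[x Sx [c1 c2]].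
  have [w wE] := tuple_of_size (size_factor x 0 k).
  have [u uE] := tuple_of_size (size_factor (proj x) k (L - k)).
  exists (w, u).
    rewrite inE; apply/andP; split; apply/wordsP.
      by exists x => //; exists 0%N.
    by exists (proj x); [exists x|exists k].
  split=> /=; rewrite wE // uE c2 map_factor.
  by rewrite -{1}(subnKC kL) factorD.
move=> c c' ww [c1 c2] [c'1 c'2].
by apply: pair_val_inj; rewrite ?c1 ?c2.
Qed.

(** Shift invariance brings the occurrence of a word to position 0, where a code
    starts. *)
Lemma card_words_le_squares S k L : shift_invariant S ->
  (#|words S k| <= #|squares S k L|)%N.
Proof.
move=> inv; apply: (@card_le_rel _ _ _ _ (fun w c => val w = val c.1)).
  move=> w /wordsP[x Sx [p wE]].
  pose y i := x (p + i)%N.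
  have [c cy] := square_codeE k L y.
  exists c; last by case: cy => -> _.
  by apply/squaresP; exists y => //; exact: (shift_invariant_iter p inv Sx).
by move=> w w' c e e'; apply: val_inj; rewrite /= e e'.
Qed.

Lemma card_proj_words_le_squares S k L j : shift_invariant S -> (j <= L)%N ->
  (#|words (proj @` S) j| <= #|squares S k L|)%N.
Proof.
move=> inv jL.
apply: (@card_le_rel _ _ _ _ (fun u c => val u = take j (val c.2))).
  move=> u /wordsP[_ [x Sx <-] [p uE]].
  pose y i := x (p + i)%N.
  have [c cy] := square_codeE k L y.
  exists c.
    by apply/squaresP; exists y => //; exact: (shift_invariant_iter p inv Sx).
  case: cy => _ ->; rewrite -(subnKC jL) factorD take_size_cat ?size_factor//.
by move=> w w' c e e'; apply: val_inj; rewrite /= e e'.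
Qed.

(** Used to forget the letters that a gap pushes beyond position [L]. *)
Lemma card_squaresDr S k L c :
  (#|squares S k (L + c)| <= #|squares S k L| * m ^ c)%N.
Proof.
have -> : (m ^ c = #|[set: c.-tuple 'I_m]%SET|)%N.
  by rewrite cardsT card_tuple card_ord.
rewrite -cardsX.
apply: (@card_le_rel _ _ _ _ (fun c cu => val c.1 = val cu.1.1 /\
  val c.2 = val cu.1.2 ++ val cu.2)).
  move=> e /squaresP[x Sx [e1 e2]].
  have [e' e'x] := square_codeE k L x.
  have [u uE] := tuple_of_size (size_factor (proj x) L c).
  exists (e', u).
    by rewrite !inE andbT; apply/asboolP; exists x.
  by case: e'x => /= -> ->; rewrite uE e1 e2 factorD.
move=> e e' cu [e1 e2] [e'1 e'2].
by apply: pair_val_inj; rewrite ?e1 ?e2.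
Qed.

(** The lower bound: a word of [S] and a projected word of [S'] are glued, with
    a gap of length at most [c], into one sequence of [T].  They are recovered
    from the length of the gap and a code long enough to see the second word
    whatever the gap. *)
Lemma card_linked_words S T S' k l c :
  (forall x y p q, S x -> S' y -> exists2 z, T z & exists2 j, (j <= c)%N &
    factor z 0 k = factor x p k /\ forall i, z (k + j + i)%N = y (q + i)%N) ->
  (#|words S k| * #|words (proj @` S') l| <=
   c.+1 * #|squares T k (k + l + c)|)%N.
Proof.
move=> link; have -> : c.+1 = #|[set: 'I_c.+1]%SET| by rewrite cardsT card_ord.
rewrite -!cardsX.
apply: (@card_le_rel _ _ _ _ (fun wu jc => val wu.1 = val jc.2.1 /\
  val wu.2 = take l (drop (k + val jc.1) (val jc.2.2)))).
  move=> [w u]; rewrite inE => /andP[/wordsP[x Sx [p wE]]].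
  move=> /wordsP[_ [y S'y <-] [q uE]].
  have [z Tz [j jc [zw zu]]] := link x y p q Sx S'y.
  have [e ez] := square_codeE k (k + l + c) z.
  exists (Ordinal (jc : (j < c.+1)%N), e).
    by rewrite finset.in_setX finset.in_setT; apply/squaresP; exists z.
  case: ez => /= -> ->; split; first by rewrite -zw in wE.
  (* The code is cut after the gap, and again after the projected word. *)
  have -> : (k + l + c = (k + j) + (l + (c - j)))%N by lia.
  rewrite factorD drop_size_cat ?size_factor// factorD.
  rewrite take_size_cat ?size_factor// add0n.
  move: uE => /= ->.
  by apply: eq_factor => i il; rewrite /proj_seq -zu.
move=> e e' cu [e1 e2] [e'1 e'2].
by apply: pair_val_inj; rewrite ?e1 ?e2.
Qed.

End approximate_squares.

(** * Paths in a labelled graph *)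

Section graphs.
Context (A : Type) (G : lgraph A).

Definition is_path (p : nat -> edge G) :=
  forall i, target (p i) = source (p i.+1).

Definition splice (k : nat) (p r : nat -> edge G) : nat -> edge G :=
  fun i => if (i < k)%N then p i else r (i - k)%N.

Lemma splice_prefix k p r i : (i < k)%N -> splice k p r i = p i.
Proof. by rewrite /splice => ->. Qed.

Lemma splice_suffix k p r i : splice k p r (k + i) = r i.
Proof. by rewrite /splice ltnNge leq_addr /= addKn. Qed.

Lemma is_path_splice k p r : is_path r ->
  (forall i, (i.+1 < k)%N -> target (p i) = source (p i.+1)) ->
  (forall i, i.+1 = k -> target (p i) = source (r 0%N)) ->
  is_path (splice k p r).
Proof.
move=> rpath pprefix plast i; rewrite /splice.
have [ik|ik|ik] := ltngtP i.+1 k.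
- by rewrite pprefix.
- by rewrite subSn.
- by rewrite -ik subnn plast.
Qed.

(** The step relation whose connectivity is [has_path] with all the edges. *)
Definition adjacent : rel (vertex G) :=
  [rel u u' | [exists e in [set: edge G]%SET,
                 (source e == u) && (target e == u')]].

Lemma path_to_edges v s (r : nat -> edge G) : is_path r ->
  path adjacent v s -> last v s = source (r 0%N) ->
  exists q, [/\ is_path q, source (q 0%N) = v &
                forall i, q (size s + i)%N = r i].
Proof.
move=> rpath; elim: s v => [|w s IH] v /=; first by move=> _ vr; exists r.
move=> /andP[/existsP[e /and3P[_ /eqP ev /eqP ew]] ws] /(IH _ ws).
move=> [q [qpath qw qr]]; exists (splice 1 (fun=> e) q); split=> //.
- by apply: is_path_splice => // i _; rewrite ew qw.
- by move=> i; rewrite addSn -add1n splice_suffix qr.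
Qed.

(** The bound on the length of the connecting path comes from removing its
    loops. *)
Lemma has_path_edges v (r : nat -> edge G) : is_path r ->
  has_path [set: edge G]%SET v (source (r 0%N)) ->
  exists2 j, (j <= #|vertex G|)%N &
    exists q, [/\ is_path q, source (q 0%N) = v &
                  forall i, q (j + i)%N = r i].
Proof.
move=> rpath /connectP[s0 /shortenP[s spath suniq _] slast].
exists (size s); last by apply: path_to_edges => //.
(* The vertices visited, [v] included, are distinct. *)
apply: leq_trans (leqnSn _) _; rewrite -[(size s).+1]/(size (v :: s)).
by rewrite -(card_uniqP suniq) max_card.
Qed.

(** The two pieces are joined along infinite paths: the first one is cut after
    [k] edges, and the second one is resumed from its [q]-th edge, after a
    connecting path. *)
Lemma link_sequences (E1 E2 : {set edge G}) k x y p q :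
  (forall e1 e2, e1 \in E1 -> e2 \in E2 ->
     has_path [set: edge G]%SET (source e1) (source e2)) ->
  label_sequences E1 x -> label_sequences E2 y ->
  exists2 z, label_sequences [set: edge G]%SET z &
  exists2 j, (j <= #|vertex G|)%N &
    factor z 0 k = factor x p k /\ forall i, z (k + j + i)%N = y (q + i)%N.
Proof.
move=> conn [a [aE apath xa]] [b [bE bpath yb]].
pose b' i := b (q + i)%N.
have b'path : is_path b' by move=> i; rewrite /b' bpath addnS.
have /(has_path_edges b'path)[j jV [c [cpath c0 cb]]] :
    has_path [set: edge G]%SET (source (a (p + k)%N)) (source (b' 0%N)).
  exact: (conn _ _ (aE _) (bE _)).
pose a' i := a (p + i)%N.
pose d := splice k a' c.
have dpath : is_path d.
  apply: is_path_splice => // i ik; first by rewrite /a' apath addnS.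
  by rewrite c0 /a' apath -ik addnS.
exists (fun i => label (d i)); first by exists d; split=> // i; rewrite inE.
exists j => //; split.
  by apply: eq_factor => i ik; rewrite /= add0n /d splice_prefix// xa.
by move=> i; rewrite /= -addnA /d splice_suffix cb yb.
Qed.

Lemma label_sequences_shift (E : {set edge G}) :
  shift_invariant (label_sequences E).
Proof.
move=> x [p [pE ppath xp]]; exists (p \o S).
by split=> i; [exact: pE|exact: ppath|exact: xp].
Qed.

Lemma sub_label_sequences (E F : {set edge G}) : E \subset F ->
  label_sequences E `<=` label_sequences F.
Proof.
move=> EF x [p [pE ppath xp]]; exists p; split=> // i.
exact: (fintype.subsetP EF).
Qed.

(** An irreducible subgraph containing [v] with the most vertices and edges is
    maximal; there is one, as [v] alone, with no edge, is irreducible. *)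
Lemma component_cover v : exists2 K : subgraph G, component K & v \in K.1.
Proof.
pose T := ({set vertex G} * {set edge G})%type.
pose P (K : T) := `[< irreducible_subgraph (K : subgraph G) >] && (v \in K.1).
pose K0 : T := ([set v]%SET, finset.set0).
have PK0 : P K0.
  rewrite /P /= inE eqxx andbT; apply/asboolP; split=> /=.
  - by move=> e; rewrite inE.
  - by exists v; rewrite inE.
  - by move=> u w; rewrite !inE => /eqP-> /eqP->; exact: connect0.
have [K /andP[/asboolP Kirr vK] Kmax] :=
  arg_maxnP (fun K : T => #|K.1| + #|K.2|)%N PK0.
exists K => //; split=> // H Hirr KH1 KH2.
have : (#|H.1| + #|H.2| <= #|K.1| + #|K.2|)%N.
  by apply: Kmax; rewrite /P (fintype.subsetP KH1)// andbT; apply/asboolP.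
have := subset_leq_card KH1; have := subset_leq_card KH2 => h2 h1 h3.
have e1 : K.1 = H.1.
  apply/eqP; rewrite eqEcard KH1 /= leqNgt; apply/negP => h.
  by have := leq_trans (leq_add h h2) h3; rewrite addSn ltnn.
have e2 : K.2 = H.2.
  apply/eqP; rewrite eqEcard KH2 /= leqNgt; apply/negP => h.
  by have := leq_trans (leq_add h1 h) h3; rewrite addnS ltnn.
by case: (H) (K) e1 e2 => [? ?] [? ?] /= -> ->.
Qed.

Lemma has_path_sub (E F : {set edge G}) v w : E \subset F ->
  has_path E v w -> has_path F v w.
Proof.
move=> EF; apply: connect_sub => a b /existsP[e /andP[eE eab]].
by apply: connect1; apply/existsP; exists e; rewrite (fintype.subsetP EF).
Qed.

Lemma component_leads_to (H K : subgraph G) v w :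
  component H -> component K -> leads_to H K -> v \in H.1 -> w \in K.1 ->
  has_path [set: edge G]%SET v w.
Proof.
move=> [[_ _ Hconn] _] [[_ _ Kconn] _] [a [b [aH bK ab]]] vH wK.
apply: (connect_trans (y := a)).
  by apply: (has_path_sub (finset.subsetT _)); exact: Hconn.
apply: (connect_trans ab).
by apply: (has_path_sub (finset.subsetT _)); exact: Kconn.
Qed.

Lemma source_has_path (H : subgraph G) e1 e2 :
  component H -> is_source H -> e1 \in H.2 ->
  has_path [set: edge G]%SET (source e1) (source e2).
Proof.
move=> Hc Hs e1H; have [K Kc e2K] := component_cover (source e2).
have [_ HK] : comps_after H K by rewrite Hs.
have [[/(_ _ e1H)[e1v _] _ _] _] := Hc.
exact: (component_leads_to Hc Kc HK e1v e2K).
Qed.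

Lemma sink_has_path (H : subgraph G) e1 e2 :
  component H -> is_sink H -> e2 \in H.2 ->
  has_path [set: edge G]%SET (source e1) (source e2).
Proof.
move=> Hc Hs e2H; have [K Kc e1K] := component_cover (source e1).
have [_ HK] : comps_before H K by rewrite Hs.
have [[/(_ _ e2H)[e2v _] _ _] _] := Hc.
exact: (component_leads_to Kc Hc HK e1K e2v).
Qed.

End graphs.

(** * Entropy *)

Section fekete.
Context (R : realType).
Implicit Types u : nat -> R.

(** Equivalent to the convergence of [u l / l] to [h], but valid for every [l]:
    the lengths to which this is applied depend on a scale [delta], and no lower
    bound on them has to be tracked. *)
Definition linear_growth u (h : R) := forall eps, 0 < eps ->
  exists C, forall l, `|u l - l%:R * h| <= eps * l%:R + C.

Lemma cvg_linear_growth u h :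
  (l%:R^-1 * u l) @[l --> \oo] --> h -> linear_growth u h.
Proof.
move=> /cvgrPdist_le uh eps eps0; have [N _ Nuh] := uh _ eps0.
(* The sum absorbs the finitely many lengths below [N], and the last term
   the length 0, where [u l / l] says nothing. *)
exists (\sum_(l < N) `|u l - l%:R * h| + `|u 0%N|) => l.
have S0 : 0 <= \sum_(l < N) `|u l - l%:R * h| by exact: sumr_ge0.
have [lN|Nl] := ltnP l N.
  have := normr_ge0 (u 0%N).
  have : 0 <= eps * l%:R by rewrite mulr_ge0// ltW.
  have : `|u l - l%:R * h| <= \sum_(l < N) `|u l - l%:R * h|.
    by rewrite (bigD1 (Ordinal lN))//= lerDl sumr_ge0.
  by lra.
have [->|l0] := posnP l.
  by rewrite mul0r subr0 mulr0 add0r lerDr.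
have l0' : 0 < l%:R :> R by rewrite ltr0n.
have := Nuh _ Nl; rewrite distrC => Hl.
have -> : u l - l%:R * h = l%:R * (l%:R^-1 * u l - h).
  by rewrite mulrBr mulVKf// gt_eqF.
rewrite normrM ger0_norm ?ler0n// mulrC.
have := normr_ge0 (u 0%N); have := ler_wpM2r (ltW l0') Hl; lra.
Qed.

Lemma subadditive_mul_le u p q r :
  (forall i j, u (i + j)%N <= u i + u j) ->
  u (q * p + r)%N <= q%:R * u p + u r.
Proof.
move=> sub; elim: q => [|q IH]; first by rewrite mul0n mul0r add0r.
rewrite mulSn -addnA -natr1 mulrDl mul1r.
have := sub p (q * p + r)%N; lra.
Qed.

(** Fekete's lemma: the limit is the infimum of [u l / l].  If the infimum is
    nearly attained at [P], Euclidean division of [l] by [P] bounds [u l] by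
    [l * (u P / P)] plus one of finitely many remainders. *)
Lemma subadditive_cvg u : (forall l, 0 <= u l) ->
  (forall i j, u (i + j)%N <= u i + u j) ->
  exists h : R, (l%:R^-1 * u l) @[l --> \oo] --> h.
Proof.
move=> u0 sub.
pose E := [set l.+1%:R^-1 * u l.+1 | l in [set: nat]].
have E0 : has_inf E.
  split; first by exists (1%:R^-1 * u 1%N); exists 0%N.
  by exists 0 => _ [l _ <-]; rewrite mulr_ge0// invr_ge0 ler0n.
exists (inf E); apply/cvgrPdist_le => eps eps0.
have e20 : 0 < eps / 2 by lra.
have [_ [p _ <-] pinf] := inf_adherent e20 E0.
set P := p.+1 in pinf.
pose M := \sum_(r < P) u r.
have M0 : 0 <= M by exact: sumr_ge0.
pose N := (Num.truncn (M / (eps / 2))).+1.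
exists N => // l /= Nl.
have l0 : (0 < l)%N by exact: leq_trans Nl.
have lR : 0 < l%:R :> R by rewrite ltr0n.
have infl : inf E <= l%:R^-1 * u l.
  apply: ge_inf; first by case: E0.
  by exists l.-1; rewrite // prednK.
have P0 : 0 < P%:R :> R by rewrite ltr0n.
have Ml : M <= eps / 2 * l%:R.
  rewrite mulrC -ler_pdivrMr//.
  apply: (le_trans (ltW (truncnS_gt _))).
  by rewrite ler_nat.
have ul : u l <= l%:R * (P%:R^-1 * u P) + M.
  rewrite {1}(divn_eq l P).
  apply: (le_trans (subadditive_mul_le _ _ _ sub)).
  have rP : (l %% P < P)%N by rewrite ltn_mod.
  have : u (l %% P)%N <= M by rewrite /M (bigD1 (Ordinal rP))//= lerDl sumr_ge0.
  suff : (l %/ P)%:R * u P <= l%:R * (P%:R^-1 * u P) by lra.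
  rewrite mulrA ler_wpM2r// ler_pdivlMr// -natrM ler_nat.
  exact: leq_trunc_div.
rewrite distrC ger0_norm; last by rewrite subr_ge0.
have : l%:R^-1 * u l <= P%:R^-1 * u P + eps / 2.
  by rewrite mulrC ler_pdivrMr// mulrDl; lra.
by lra.
Qed.

End fekete.

(** The limit that defines the entropy exists for any set of sequences, even for
    the empty one, since [ln 0 = 0]. *)
Lemma entropy_linear_growth (R : realType) (A : finType) (S : set (nat -> A)) :
  linear_growth (fun l => ln (#|words S l|%:R : R)) (entropy R S).
Proof.
apply: cvg_linear_growth; rewrite /entropy.
suff [h uh] : exists h : R,
    (l%:R^-1 * ln (#|words S l|%:R : R)) @[l --> \oo] --> h.
  by rewrite (cvg_lim _ uh).
apply: subadditive_cvg => [l|i j].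
  have [->|w0] := posnP #|words S l|; first by rewrite ln0.
  by rewrite ln_ge0// ler1n.
have [->|/set0P S0] := eqVneq S set0.
  by rewrite !words_set0 !cards0 ln0// addr0.
have w0 k : 0 < #|words S k|%:R :> R by rewrite ltr0n card_words_gt0.
by rewrite -lnM ?posrE// ler_ln ?posrE ?mulr_gt0// -natrM ler_nat card_wordsD.
Qed.

(** * Expansions in an integer base *)

Section expansions.
Context (R : realType) (b : nat) (b0 : (0 < b)%N).
Implicit Types s t : seq 'I_b.

(** The number [0.d_0 d_1 ... d_(l - 1)] in base [b]. *)
Definition expansion s : R := foldr (fun (d : 'I_b) p => (p + d%:R) / b%:R) 0 s.

(** The integer whose base [b] digits are those of [s], the most significant one
    first. *)
Definition numeral s : nat := foldl (fun N (d : 'I_b) => N * b + d)%N 0%N s.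

Let bR : 0 < b%:R :> R. Proof. by rewrite ltr0n. Qed.

Lemma expansion_itv s : 0 <= expansion s <= 1.
Proof.
elim: s => [|d s /andP[s0 s1]] /=; first by rewrite lexx ler01.
rewrite divr_ge0 ?addr_ge0 ?ler0n//= ler_pdivrMr// mul1r.
have : d.+1%:R <= b%:R :> R by rewrite ler_nat.
by rewrite -natr1; lra.
Qed.

Lemma expansion_cat s t :
  expansion (s ++ t) = ((numeral s)%:R + expansion t) / b%:R ^+ size s.
Proof.
elim/last_ind: s t => [|s d IH] t; first by rewrite /= add0r expr0 divr1.
rewrite cat_rcons IH /= /numeral foldl_rcons size_rcons -/(numeral s).
rewrite natrD natrM exprS.
field.
by rewrite expf_neq0 gt_eqF.
Qed.

Lemma expansion_prefix s t :
  (numeral s)%:R <= b%:R ^+ size s * expansion (s ++ t) <= (numeral s)%:R + 1.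
Proof.
rewrite expansion_cat mulrCA divff ?mulr1; last by rewrite expf_neq0 ?gt_eqF.
by have := expansion_itv t; lra.
Qed.

Lemma numeral_inj s t : size s = size t -> numeral s = numeral t -> s = t.
Proof.
elim/last_ind: s t => [|s d IH] t; first by case: t.
case/lastP: t => [|t e]; first by rewrite size_rcons.
rewrite !size_rcons => -[st]; rewrite /numeral !foldl_rcons -/(numeral s).
rewrite -/(numeral t) => eq_st.
have dm (i : 'I_b) N : ((N * b + i) %/ b = N)%N.
  by rewrite divnMDl// divn_small ?addn0.
have eN : numeral s = numeral t 
  by have := dm d (numeral s); rewrite eq_st dm.
move: eq_st; rewrite eN => /addnI/val_inj->.
by rewrite (IH _ st eN).
Qed.

(** Appending a digit increases the expansion, which never exceeds 1. *)
Lemma expansion_cvg (x : nat -> 'I_b) : cvgn (fun l => expansion (mkseq x l)).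
Proof.
apply: nondecreasing_is_cvgn; last first.
  by exists 1 => _ [l _ <-]; have /andP[] := expansion_itv (mkseq x l).
apply/nondecreasing_seqP => l; rewrite mkseqS -cats1.
rewrite -{1}[mkseq x l]cats0 !expansion_cat ler_wpM2r ?invr_ge0 ?exprn_ge0//.
by rewrite lerD2l; have /andP[] := expansion_itv [:: x l].
Qed.

Lemma lim_expansion_prefix (x : nat -> 'I_b) k (z : R) :
  expansion (mkseq x l) @[l --> \oo] --> z ->
  (numeral (factor x 0 k))%:R <= b%:R ^+ k * z
    <= (numeral (factor x 0 k))%:R + 1.
Proof.
move=> xz.
have bk0 : 0 < b%:R ^+ k :> R by exact: exprn_gt0.
have near_prefix : \forall l \near \oo,
    (numeral (factor x 0 k))%:R / b%:R ^+ k <= expansion (mkseq x l)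
    <= ((numeral (factor x 0 k))%:R + 1) / b%:R ^+ k.
  exists k => // l /= kl.
  rewrite ler_pdivlMr// ler_pdivrMr// ![_ * b%:R ^+ k]mulrC.
  have -> : mkseq x l = factor x 0 k ++ factor x k (l - k).
    by rewrite -(factorD x 0) subnKC.
  have := expansion_prefix (factor x 0 k) (factor x k (l - k)).
  by rewrite size_factor.
have zE : limn (fun l => expansion (mkseq x l)) = z by exact: (cvg_lim _ xz).
have xc := @expansion_cvg x.
rewrite [_ * z]mulrC; apply/andP; split.
- rewrite -[_ <= _](ler_pdivrMr _ _ bk0) -zE; apply: limr_ge => //.
  by apply: filterS near_prefix => l /andP[].
- rewrite -[_ <= _](ler_pdivlMr _ _ bk0) -zE; apply: limr_le => //.
  by apply: filterS near_prefix => l /andP[].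
Qed.

End expansions.

(** * Covers by approximate squares *)

Section plane.
Context (R : realType).
Implicit Types (E U : set (R * R)) (p q : R * R) (delta : R).

Lemma le_edist p q :
  `|p.1 - q.1| <= Defs.edist p q /\ `|p.2 - q.2| <= Defs.edist p q.
Proof.
by split; rewrite /Defs.edist -sqrtr_sqr ler_wsqrtr// ?lerDl ?lerDr sqr_ge0.
Qed.

Lemma edist_le_diameter U p q delta : diameter U = delta%:E ->
  U p -> U q -> Defs.edist p q <= delta.
Proof.
move=> Ud Up Uq; rewrite -lee_fin -Ud; apply: ereal_sup_ubound.
by exists p => //; exists q.
Qed.

Definition square (a : R * R) (s : R) : set (R * R) :=
  [set p | (a.1 <= p.1 <= a.1 + s) && (a.2 <= p.2 <= a.2 + s)].

(** Covers must consist of sets of diameter exactly [delta]; closed squares of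
    side [delta / sqrt 2] achieve this. *)
Lemma diameter_square a delta : 0 <= delta ->
  diameter (square a (delta / Num.sqrt 2)) = delta%:E.
Proof.
move=> d0; set s := delta / _.
have s0 : 0 <= s by rewrite divr_ge0// sqrtr_ge0.
have s2 : s ^+ 2 + s ^+ 2 = delta ^+ 2.
  by rewrite /s expr_div_n sqr_sqrtr ?ler0n//; field.
apply/eqP; rewrite eq_le; apply/andP; split.
- apply: ge_ereal_sup => _ [p + [q + <-]].
  move=> /andP[/andP[? ?] /andP[? ?]] /andP[/andP[? ?] /andP[? ?]].
  rewrite lee_fin /Defs.edist -(ger0_norm d0) -sqrtr_sqr ler_wsqrtr// -s2.
  by apply: lerD; rewrite -real_normK ?num_real// ler_sqr ?nnegrE// ler_norml;
    lra.
- apply: ereal_sup_ubound; exists a; first by rewrite /square /=; lra.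
  exists (a.1 + s, a.2 + s); first by rewrite /square /=; lra.
  rewrite /Defs.edist /= !opprD !addrA !subrr !sub0r !sqrrN s2 sqrtr_sqr.
  by rewrite ger0_norm.
Qed.

Lemma covering_numberP E delta N : coverable E delta N ->
  coverable E delta (covering_number E delta) /\
  (covering_number E delta <= N)%N.
Proof.
move=> EN.
suff [M [EM Mmin]] : exists M, coverable E delta M /\
    forall M', coverable E delta M' -> (M <= M')%N.
  have [h1 h2] := @xgetPex _ 0%N [set N | coverable E delta N /\
    forall M, coverable E delta M -> (N <= M)%N] (ex_intro _ M (conj EM Mmin)).
  by split; [exact: h1|exact: h2].
have ex : exists M, `[< coverable E delta M >] by exists N; exact/asboolP.
exists (ex_minn ex); case: ex_minnP => M /asboolP EM Mmin; split=> // M' EM'.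
by apply: Mmin; exact/asboolP.
Qed.

End plane.

Section coding.
Context (R : realType) (m n : nat) (m0 : (0 < m)%N) (n0 : (0 < n)%N).
Implicit Types (S : set (nat -> digit m n)) (x : nat -> digit m n).
Local Notation proj := (@proj_seq m n).
Local Notation Pi := (@coding_map R m n).

Lemma foldr_grid_map (s : seq (digit m n)) :
  foldr (@grid_map R m n) (0, 0) s =
  (expansion R (map fst s), expansion R (map snd s)).
Proof.
elim: s => [//|d s IH] /=; rewrite IH /grid_map /=.
by congr pair; congr (_ / _); rewrite -natr1 addrA addrK.
Qed.

(** The coding map is a chosen limit in the plane; it exists because both
    coordinates converge, and any choice has the limits of the coordinates. *)
Lemma coding_map_cvg x :
  expansion R (mkseq (proj x) l) @[l --> \oo] --> (Pi x).1 /\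
  expansion R (mkseq (snd \o x) l) @[l --> \oo] --> (Pi x).2.
Proof.
have c1 := @expansion_cvg R m m0 (proj x).
have c2 := @expansion_cvg R n n0 (snd \o x).
pose z : R * R := (limn (fun l => expansion R (mkseq (proj x) l)),
                   limn (fun l => expansion R (mkseq (snd \o x) l))).
have fE : (fun l => foldr (@grid_map R m n) (0, 0) (mkseq x l)) =
    (fun l => (expansion R (mkseq (proj x) l),
               expansion R (mkseq (snd \o x) l))).
  by apply/funext => l; rewrite foldr_grid_map /mkseq -!map_comp.
have : (fun l => foldr (@grid_map R m n) (0, 0) (mkseq x l)) @ \oo --> Pi x.
  apply: (@getPex (R * R)%type [set z : R * R |
    (fun l => foldr (@grid_map R m n) (0, 0) (mkseq x l)) @ \oo --> z]).
  by exists z => /=; rewrite fE; exact: (cvg_pair c1 c2).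
rewrite fE => h; split.
- exact: (cvg_comp _ _ h (@cvg_fst _ _ _ _ _)).
- exact: (cvg_comp _ _ h (@cvg_snd _ _ _ _ _)).
Qed.

Lemma coding_map_square k L x c : @square_code m n k L x c ->
  (numeral (val c.2))%:R <= m%:R ^+ L * (Pi x).1
    <= (numeral (val c.2))%:R + 1 /\
  (numeral (map snd (val c.1)))%:R <= n%:R ^+ k * (Pi x).2
    <= (numeral (map snd (val c.1)))%:R + 1.
Proof.
move=> [-> ->]; rewrite map_factor; have [h1 h2] := coding_map_cvg x.
by split; apply: lim_expansion_prefix.
Qed.

(** The two integers locating an approximate square on the grid determine its
    code: the second one only records the coordinates [b_i] for [i < k], and the
    matching [a_i] are the first [k] digits of the first one, as [k <= L]. *)
Lemma square_code_inj k L x x' c c' : (k <= L)%N ->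
  @square_code m n k L x c -> @square_code m n k L x' c' ->
  numeral (val c.2) = numeral (val c'.2) ->
  numeral (map snd (val c.1)) = numeral (map snd (val c'.1)) -> c = c'.
Proof.
move=> kL [c1 c2] [c'1 c'2] e2 e1.
have {}e2 : val c.2 = val c'.2.
  by apply: (numeral_inj m0) e2; rewrite !size_tuple.
have {}e1 : map snd (val c.1) = map snd (val c'.1).
  by apply: (numeral_inj n0) e1; rewrite !size_map !size_tuple.
have e3 : map fst (val c.1) = map fst (val c'.1).
  have takeE (y : nat -> 'I_m) : take k (factor y 0 L) = factor y 0 k.
    by rewrite -(subnKC kL) factorD take_size_cat ?size_factor.
  by rewrite c1 c'1 !map_factor -!takeE -c2 -c'2 e2.
apply: pair_val_inj => //.
rewrite -[LHS]zip_unzip -[RHS]zip_unzip.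
by rewrite /unzip1 /unzip2 e1 e3.
Qed.

(** At this scale each approximate square, closed, fits in a square of diameter
    [delta]: its sides are at most [n^-k <= delta / 2 <= delta / sqrt 2]. *)
Lemma coverable_squares S k L delta :
  2 <= n%:R ^+ k * delta -> (n ^ k <= m ^ L)%N ->
  coverable (Pi @` S) delta #|squares S k L|.
Proof.
move=> kd kL.
have nk0 : 0 < n%:R ^+ k :> R by rewrite exprn_gt0// ltr0n.
have mL0 : 0 < m%:R ^+ L :> R by rewrite exprn_gt0// ltr0n.
have kL' : n%:R ^+ k <= m%:R ^+ L :> R by rewrite -!natrX ler_nat.
have d0 : 0 < delta by rewrite -(pmulr_rgt0 _ nk0); lra.
set s := delta / Num.sqrt 2.
have s0 : 0 <= s by rewrite divr_ge0 ?sqrtr_ge0// ltW.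
have ds : delta / 2 <= s.
  have : (delta / 2) ^+ 2 <= s ^+ 2.
    rewrite /s !expr_div_n sqr_sqrtr ?ler0n// ler_wpM2l ?sqr_ge0//.
    by lra.
  by rewrite ler_sqr ?nnegrE// divr_ge0// ltW.
have ks : 1 <= n%:R ^+ k * s.
  have : n%:R ^+ k * (delta / 2) <= n%:R ^+ k * s by rewrite ler_pM2l.
  by lra.
have Ls : 1 <= m%:R ^+ L * s.
  by apply: (le_trans ks); rewrite ler_wpM2r.
pose corner (c : k.-tuple (digit m n) * L.-tuple 'I_m) : R * R :=
  ((numeral (val c.2))%:R / m%:R ^+ L,
   (numeral (map snd (val c.1)))%:R / n%:R ^+ k).
exists (fun i => square (corner (enum_val i)) s); split.
  by move=> i; apply: diameter_square; exact: ltW.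
move=> _ [x Sx <-]; have [c cx] := square_codeE k L x.
have cS : c \in squares S k L by apply/squaresP; exists x.
exists (enum_rank_in cS c) => //=; rewrite enum_rankK_in//.
have [/andP[h1 h2] /andP[h3 h4]] := coding_map_square cx.
rewrite /square /corner /=; apply/andP; split.
- rewrite ler_pdivrMr// mulrC h1 /= -(ler_pM2l mL0) mulrDr mulrCA divff.
    by lra.
  by rewrite gt_eqF.
- rewrite ler_pdivrMr// mulrC h3 /= -(ler_pM2l nk0) mulrDr mulrCA divff.
    by lra.
  by rewrite gt_eqF.
Qed.

(** Two reals at distance at most [1 / M] lie in intervals of the grid of step
    [1 / M] whose indices differ by at most 2, even if they are end points of
    several intervals; residues modulo 3 then separate the indices. *)
Lemma near_numerals (M z z' delta : R) (P P' : nat) :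
  0 <= M -> P%:R <= M * z <= P%:R + 1 -> P'%:R <= M * z' <= P'%:R + 1 ->
  `|z - z'| <= delta -> M * delta <= 1 -> (P %% 3 = P' %% 3)%N -> P = P'.
Proof.
move=> M0 /andP[h1 h2] /andP[h3 h4]; rewrite ler_norml => /andP[h5 h6] Md eqP3.
have h7 : M * (z - z') <= M * delta by rewrite ler_wpM2l.
have h8 : M * (- delta) <= M * (z - z') by rewrite ler_wpM2l.
have : P%:R <= P'%:R + 2%:R :> R by lra.
have : P'%:R <= P%:R + 2%:R :> R by lra.
by rewrite -!natrD !ler_nat; lia.
Qed.

(** Images of sequences with ten distinct codes cannot lie in one set of diameter
    [delta]: two of the codes would have the same residues modulo 3 for both
    coordinates of their approximate squares, hence be equal. *)
Lemma card_squares_le_cover S k L delta N : (k <= L)%N ->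
  n%:R ^+ k * delta <= 1 -> (m ^ L <= n ^ k)%N -> 0 <= delta ->
  coverable (Pi @` S) delta N -> (#|squares S k L| <= N * 9)%N.
Proof.
move=> kL kd Lk d0 [U [Ud SU]].
have kL' : m%:R ^+ L <= n%:R ^+ k :> R by rewrite -!natrX ler_nat.
have Ld : m%:R ^+ L * delta <= 1.
  by apply: le_trans kd; rewrite ler_wpM2r.
have -> : (N * 9)%N = #|[set: 'I_N * ('I_3 * 'I_3)]%SET|.
  by rewrite cardsT !card_prod !card_ord.
apply: (@card_le_rel _ _ _ _ (fun (c : k.-tuple (digit m n) * L.-tuple 'I_m)
    (t : 'I_N * ('I_3 * 'I_3)) => exists x, [/\ square_code x c,
  U t.1 (Pi x), numeral (val c.2) %% 3 = t.2.1 &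
  numeral (map snd (val c.1)) %% 3 = t.2.2]%N)).
  move=> c /squaresP[x Sx cx].
  have [|i _ Ux] := SU (Pi x); first by exists x.
  exists (i, (inZp (numeral (val c.2)), inZp (numeral (map snd (val c.1))))).
    by rewrite finset.in_setT.
  by exists x.
move=> c c' t [x [cx Ux a1 a2]] [x' [cx' Ux' a'1 a'2]].
have [d1 d2] := le_edist (Pi x) (Pi x').
have dd := edist_le_diameter (Ud t.1) Ux Ux'.
have [h1 h2] := coding_map_square cx.
have [h'1 h'2] := coding_map_square cx'.
apply: (square_code_inj kL cx cx').
- apply: (near_numerals _ h1 h'1 (le_trans d1 dd)) => //.
  by rewrite a1 a'1.
- apply: (near_numerals _ h2 h'2 (le_trans d2 dd)) => //.
  by rewrite a2 a'2.
Qed.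

End coding.

(** * Asymptotics *)

Lemma cvg_limf_esup (R : realType) (F : set_system R) (f : R -> R) (s : R) :
  ProperFilter F -> f x @[x --> F] --> s ->
  limf_esup (fun x => (f x)%:E) F = s%:E.
Proof.
move=> PF /cvgrPdist_le fs; rewrite limf_esupE.
apply/eqP; rewrite eq_le; apply/andP; split.
- apply/lee_addgt0Pr => e e0.
  apply: ge_ereal_inf.
  exists (ereal_sup ((fun x => (f x)%:E) @` [set x | `|s - f x| <= e])).
    by exists [set x | `|s - f x| <= e] => //; exact: fs.
  apply: ge_ereal_sup => _ [x /= + <-].
  by rewrite -EFinD lee_fin ler_norml => /andP[+ _]; lra.
- apply: le_ereal_inf_tmp => _ [V FV <-].
  apply/lee_addgt0Pr => e e0.
  have [x [Vx /=]] := filter_ex (filterI FV (fs e e0)).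
  rewrite ler_norml => /andP[_ h].
  apply: (@le_trans _ _ ((f x)%:E + e%:E)%E).
    by rewrite -EFinD lee_fin; lra.
  by rewrite leeD2r//; apply: ereal_sup_ubound; exists x.
Qed.

(** An error linear in [- ln delta] with small slope, plus a constant, vanishes
    in the limit after division by [- ln delta]. *)
Lemma has_box_dim_linear (R : realType) (E : set (R * R)) (s : R) :
  (forall eps, 0 < eps -> exists C, forall delta, 0 < delta < 1 ->
     `|ln (covering_number E delta)%:R - s * - ln delta|
       <= eps * - ln delta + C) ->
  has_box_dim E s.
Proof.
move=> H.
pose r delta : R := ln (covering_number E delta)%:R / - ln delta.
have rs : r delta @[delta --> 0^'+] --> s.
  apply/cvgrPdist_le => e e0.
  have [C HC] := H (e / 2) ltac:(lra).
  (* The constant is absorbed as soon as [C <= e / 2 * - ln delta]. *)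
  pose T := `|C| / (e / 2) + 1.
  have T0 : 0 < T by rewrite ltr_pwDr// divr_ge0//; lra.
  near=> delta.
  have d0 : 0 < delta by near: delta; exact: nbhs_right_gt.
  have dT : delta < expR (- T).
    by near: delta; apply: nbhs_right_lt; exact: expR_gt0.
  have tT : T < - ln delta.
    by rewrite ltrNr -ltr_expR lnK// posrE.
  have d1 : delta < 1.
    by rewrite (lt_trans dT)// -expR0 ltr_expR oppr_lt0.
  have := HC delta; rewrite d0 d1 => /(_ isT).
  have t0 : 0 < - ln delta by exact: lt_trans tT.
  set t := - ln delta in tT t0 * => Hr.
  have Ct : C <= e / 2 * t.
    apply: (le_trans (ler_norm _)); rewrite mulrC -ler_pdivrMr; last by lra.
    by rewrite /T in tT; lra.
  rewrite distrC /r -/t -(ler_pM2r t0) -[X in _ * X <= _](ger0_norm (ltW t0)).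
  rewrite -normrM mulrBl divfK ?gt_eqF//.
  by lra.
rewrite /has_box_dim /lower_box_dim /upper_box_dim; split.
- rewrite /limf_einf.
  rewrite (_ : (fun x => - box_ratio E x)%E = (fun x => (- r x)%:E))//.
  by rewrite (cvg_limf_esup (s := - s)) ?EFinN ?oppeK//; exact: cvgN.
- exact: cvg_limf_esup.
Unshelve. all: end_near. Qed.

(** With [k] close to [a t] and [k + l] close to [b t], the sum [u k + v l] is
    close to [h a t + g (b - a) t].  For [a = 1 / ln n] and [b = 1 / ln m] the
    coefficient of [t] is the dimension sought. *)
Lemma linear_growth_sum (R : realType) (u v : nat -> R) (h g a b D : R) :
  linear_growth u h -> linear_growth v g -> 0 < b ->
  forall eps, 0 < eps -> exists C, forall t k l,
    `|k%:R - a * t| <= D -> `|(k + l)%N%:R - b * t| <= D ->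
    `|u k + v l - (h * a + g * (b - a)) * t| <= eps * t + C.
Proof.
move=> uh vg b0 eps eps0.
have e0 : 0 < eps / b by rewrite divr_gt0.
have [C1 HC1] := uh _ e0; have [C2 HC2] := vg _ e0.
exists (C1 + C2 + eps / b * D + D * `|h| + 2 * D * `|g|) => t k l kD klD.
have h1 := HC1 k; have h2 := HC2 l.
have h3 : `|(k%:R - a * t) * h| <= D * `|h| by rewrite normrM ler_wpM2r.
have h4 : `|(l%:R - (b - a) * t) * g| <= 2 * D * `|g|.
  rewrite normrM ler_wpM2r//.
  by move: kD klD; rewrite natrD !ler_norml => /andP[? ?] /andP[? ?]; lra.
have h5 : eps / b * (k%:R + l%:R) <= eps * t + eps / b * D.
  have -> : eps * t = eps / b * (b * t) by field; exact: lt0r_neq0.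
  rewrite -mulrDr ler_pM2l//.
  by move: klD; rewrite natrD ler_norml => /andP[? ?]; lra.
move: h1 h2 h3 h4; rewrite !ler_norml.
by move=> /andP[? ?] /andP[? ?] /andP[? ?] /andP[? ?]; lra.
Qed.

Section scales.
Context (R : realType) (m n : nat) (m2 : (2 <= m)%N) (mn : (m < n)%N).

Let lm0 : 0 < ln m%:R :> R. Proof. by rewrite ln_gt0// ltr1n. Qed.
Let lnn0 : 0 < ln n%:R :> R.
Proof. by rewrite ln_gt0// ltr1n (leq_trans m2)// ltnW. Qed.
Let m0 : (0 < m)%N. Proof. lia. Qed.
Let n0 : (0 < n)%N. Proof. lia. Qed.

Let ln_nat_exp (p k : nat) : (0 < p)%N ->
  ln (p ^ k)%N%:R = k%:R * ln p%:R :> R.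
Proof. by move=> p0; rewrite natrX lnXn ?ltr0n// mulr_natl. Qed.

Let ln_le_nat (p q : nat) : (0 < p)%N -> (p <= q)%N -> ln p%:R <= ln q%:R :> R.
Proof.
move=> p0 pq; rewrite ler_ln ?posrE ?ltr0n ?ler_nat//.
exact: leq_trans pq.
Qed.

(** A bound, uniform in [delta], on the distance of the chosen levels [k] and
    [L] to the reals [- ln delta / ln n] and [- ln delta / ln m]. *)
Definition scale_error : R := 3 + 2 * (ln n%:R / ln m%:R).

Definition at_scale (delta : R) (k L : nat) :=
  `|k%:R - (ln n%:R)^-1 * - ln delta| <= scale_error /\
  `|L%:R - (ln m%:R)^-1 * - ln delta| <= scale_error.

Let D_ge0 : 0 <= ln n%:R / ln m%:R :> R.
Proof. by rewrite divr_ge0// ltW. Qed.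

Let depth_leq k : (k <= trunc_log m (n ^ k))%N.
Proof.
apply: trunc_log_max => //; case: k => [//|k].
by rewrite leq_exp2r// ltnW.
Qed.

Let base_depth (delta : R) : 0 < delta < 1 ->
  exists k, [/\ (n ^ k)%N%:R * delta <= 1, 1 < (n ^ k.+1)%N%:R * delta,
    k%:R * ln n%:R <= - ln delta & - ln delta <= k%:R * ln n%:R + ln n%:R].
Proof.
move=> /andP[d0 d1].
(* The logarithm in base [n] is taken of the integer part of [1 / delta]. *)
pose T := Num.truncn delta^-1.
have T1 : (0 < T)%N by rewrite truncn_gt0 invf_ge1 // ltW.
pose k := trunc_log n T.
have n1 : (1 < n)%N by lia.
have kT : (n ^ k)%N%:R <= delta^-1.
  apply: (@le_trans _ _ T%:R); first by rewrite ler_nat trunc_logP.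
  by rewrite truncn_le invr_ge0 ltW.
have Tk : delta^-1 < (n ^ k.+1)%N%:R.
  apply: (lt_le_trans (truncnS_gt _)).
  by rewrite ler_nat; exact: trunc_log_ltn.
exists k; split.
- by rewrite -ler_pdivlMr// div1r.
- by rewrite -ltr_pdivrMr// div1r.
- rewrite -lnV ?posrE// -ln_nat_exp// ler_ln ?posrE ?invr_gt0//.
  by rewrite ltr0n expn_gt0 n0.
- have -> : k%:R * ln n%:R + ln n%:R = k.+1%:R * ln n%:R :> R.
    by rewrite -natr1 mulrDl mul1r.
  rewrite -lnV ?posrE// -ln_nat_exp//.
  by rewrite ler_ln ?posrE ?invr_gt0// ?(ltW Tk)// ltr0n expn_gt0 n0.
Qed.

Let depth_bounds k : let L := trunc_log m (n ^ k) in
  L%:R * ln m%:R <= k%:R * ln n%:R :> R /\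
  k%:R * ln n%:R <= L%:R * ln m%:R + ln m%:R :> R.
Proof.
have nk0 : (0 < n ^ k)%N by rewrite expn_gt0 n0.
have addl (x : R) (p : nat) : p%:R * x + x = p.+1%:R * x.
  by rewrite -natr1 mulrDl mul1r.
rewrite /= addl// -!ln_nat_exp//; split.
  by apply: ln_le_nat; [rewrite expn_gt0 m0|exact: trunc_logP].
by apply: ln_le_nat => //; apply/ltnW/trunc_log_ltn.
Qed.

Let at_scale_bounds (delta : R) k L :
  `|k%:R * ln n%:R - - ln delta| <= 2 * ln n%:R ->
  `|L%:R * ln m%:R - - ln delta| <= 2 * ln n%:R + ln m%:R ->
  at_scale delta k L.
Proof.
set t := - ln delta => hk hL; split.
- apply: (@le_trans _ _ 2); last by rewrite /scale_error; have := D_ge0; lra.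
  rewrite -(ler_pM2r lnn0) -[X in _ * X <= _](ger0_norm (ltW lnn0)) -normrM.
  by rewrite mulrBl mulrAC mulVf ?gt_eqF// mul1r.
- apply: (@le_trans _ _ (1 + 2 * (ln n%:R / ln m%:R)));
    last by rewrite /scale_error; lra.
  rewrite -(ler_pM2r lm0) -[X in _ * X <= _](ger0_norm (ltW lm0)) -normrM.
  rewrite mulrBl mulrAC mulVf ?gt_eqF// mul1r.
  rewrite [X in _ <= X]mulrDl -mulrA divfK ?gt_eqF// mul1r.
  by rewrite [X in _ <= X]addrC.
Qed.

(** Levels whose approximate squares have sides at least [delta], so that a set
    of diameter [delta] meets few of them. *)
Lemma inner_scale (delta : R) : 0 < delta < 1 -> exists k L,
  [/\ (k <= L)%N, (m ^ L <= n ^ k)%N, n%:R ^+ k * delta <= 1 &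
      at_scale delta k L].
Proof.
move=> /base_depth[k [k1 _ k3 k4]]; exists k, (trunc_log m (n ^ k)).
have [L1 L2] := depth_bounds k; have ? := lm0; have ? := lnn0.
split=> //; first by rewrite trunc_logP ?expn_gt0 ?n0.
- by rewrite -natrX.
- by apply: at_scale_bounds; rewrite ler_norml; lra.
Qed.

(** Levels whose approximate squares have sides at most [delta / 2].  If [n^k]
    is the largest power of [n] up to [1 / delta], then [n^(k + 1) delta > 1],
    and one more factor [n >= 2] gives the bound; this is why [k.+2] is used. *)
Lemma outer_scale (delta : R) : 0 < delta < 1 -> exists k L,
  [/\ (k <= L)%N, (n ^ k <= m ^ L)%N, 2 <= n%:R ^+ k * delta &
      at_scale delta k L].
Proof.
move=> /[dup] /andP[d0 _] /base_depth[k [_ k2 k3 k4]].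
exists k.+2, (trunc_log m (n ^ k.+2)).+1.
have [L1 L2] := depth_bounds k.+2; have ? := lm0; have ? := lnn0.
split=> //; first exact/leqW/depth_leq.
- exact/ltnW/trunc_log_ltn.
- rewrite exprS -natrX -mulrA -[X in X <= _]mulr1 ler_pM//; last exact: ltW.
  by rewrite ler_nat; lia.
- move: L1 L2; rewrite -!natr1 => L1 L2.
  by apply: at_scale_bounds; rewrite -!natr1 ler_norml; lra.
Qed.

End scales.

(** * Dimension *)

Section dimension.
Context (R : realType) (m n : nat) (m2 : (2 <= m)%N) (mn : (m < n)%N).
Variable S : set (nat -> digit m n).
Local Notation proj := (@proj_seq m n).

Let m0 : (0 < m)%N. Proof. lia. Qed.
Let n0 : (0 < n)%N. Proof. lia. Qed.

(** The upper bound on the covering number always has the right order; a lower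
    bound by sequences [alpha] and [beta] with the growth rates of the two
    languages therefore determines the dimension. *)
Lemma box_dim_of_words (alpha beta : nat -> nat) (K : nat) :
  S !=set0 ->
  (forall k, (0 < alpha k)%N) -> (forall k, (0 < beta k)%N) ->
  linear_growth (fun k => ln ((alpha k)%:R : R)) (entropy R S) ->
  linear_growth (fun k => ln ((beta k)%:R : R)) (entropy R (proj @` S)) ->
  (forall k l, (alpha k * beta l <= K * #|squares S k (k + l)|)%N) ->
  has_box_dim (@coding_map R m n @` S)
    (entropy R (proj @` S) / ln m%:R
     + (entropy R S - entropy R (proj @` S)) / ln n%:R).
Proof.
move=> S0 alpha0 beta0 alphah betag ab.
set h := entropy R S in alphah *; set g := entropy R _ in betag *.
have pS0 : proj @` S !=set0 by case: S0 => x Sx; exists (proj x), x.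
have lnm : 0 < (ln m%:R)^-1 :> R by rewrite invr_gt0 ln_gt0// ltr1n.
apply: has_box_dim_linear => e e0.
have [C1 HC1] := linear_growth_sum (ln n%:R)^-1 (scale_error R m n)
  (@entropy_linear_growth R _ S) (@entropy_linear_growth R _ (proj @` S))
  lnm e0.
have [C2 HC2] := linear_growth_sum (ln n%:R)^-1 (scale_error R m n)
  alphah betag lnm e0.
pose B : R := ln (K * 9)%N%:R.
exists (`|C1| + `|C2 + B|) => delta d01; have /andP[d0 d1] := d01.
have [k [L [kL kLmn kd [ks Ls]]]] := outer_scale m2 mn d01.
have [k' [L' [kL' kLmn' kd' [ks' Ls']]]] := inner_scale m2 mn d01.
have cov := coverable_squares m0 n0 S kd kLmn.
have [covN Nle] := covering_numberP cov.
set N := covering_number _ _ in covN Nle *.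
set t := - ln delta in ks Ls ks' Ls' *.
have -> : g / ln m%:R + (h - g) / ln n%:R =
    h * (ln n%:R)^-1 + g * ((ln m%:R)^-1 - (ln n%:R)^-1) by ring.
set s := h * _ + _.
have lnM_nat (p q : nat) : (0 < p)%N -> (0 < q)%N ->
    ln (p * q)%N%:R = ln p%:R + ln q%:R :> R.
  by move=> p0 q0; rewrite natrM lnM// posrE ltr0n.
have ln_le_nat (p q : nat) : (0 < p)%N -> (p <= q)%N ->
    ln p%:R <= ln q%:R :> R.
  by move=> p0 pq; rewrite ler_ln ?posrE ?ltr0n ?ler_nat// (leq_trans p0).
have ab' := ab k' (L' - k')%N; rewrite subnKC// in ab'.
have sqN := card_squares_le_cover m0 n0 kL' kd' kLmn' (ltW d0) covN.
have abN : (alpha k' * beta (L' - k') <= K * 9 * N)%N.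
  by apply: (leq_trans ab'); rewrite -mulnA leq_mul2l mulnC sqN orbT.
have ab0 : (0 < alpha k' * beta (L' - k'))%N by rewrite muln_gt0 alpha0 beta0.
have KN0 : (0 < K * 9 * N)%N by exact: leq_trans abN.
have [K0 N0] : (0 < K * 9)%N /\ (0 < N)%N.
  by move: KN0; rewrite muln_gt0 => /andP.
have low : ln (alpha k')%:R + ln (beta (L' - k')%N)%:R <= B + ln N%:R.
  by rewrite -lnM_nat// -lnM_nat// ln_le_nat.
have NW : (N <= #|words S k| * #|words (proj @` S) (L - k)|)%N.
  exact: leq_trans Nle (card_squares_le _ kL).
have up : ln N%:R <=
    ln #|words S k|%:R + ln #|words (proj @` S) (L - k)|%:R :> R.
  by rewrite -lnM_nat ?card_words_gt0// ln_le_nat.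
have := HC1 t k (L - k)%N ks; rewrite subnKC// => /(_ Ls).
have := HC2 t k' (L' - k')%N ks'; rewrite subnKC// => /(_ Ls').
rewrite -/s; have := ler_norm C1; have := ler_norm (C2 + B).
have := normr_ge0 C1; have := normr_ge0 (C2 + B).
by rewrite !ler_norml => ? ? ? ? /andP[? ?] /andP[? ?]; lra.
Qed.

(** [S1] or [S2] is empty when it comes from a component with one vertex and no
    edge.  Numbers of words are therefore replaced by their maximum with 1, which
    has the same logarithm since [ln 0 = 0 = ln 1]; when a number is 0, the
    inequality to be proved only compares [squares] with the words of [S], or of
    its projection. *)
Lemma box_dim_of_linked (S1 S2 : set (nat -> digit m n)) (c : nat) :
  S !=set0 -> shift_invariant S -> S1 `<=` S -> S2 `<=` S ->
  entropy R S1 = entropy R S ->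
  entropy R (proj @` S2) = entropy R (proj @` S) ->
  (forall x y k p q, S1 x -> S2 y -> exists2 z, S z & exists2 j, (j <= c)%N &
    factor z 0 k = factor x p k /\ forall i, z (k + j + i)%N = y (q + i)%N) ->
  has_box_dim (@coding_map R m n @` S)
    (entropy R (proj @` S) / ln m%:R
     + (entropy R S - entropy R (proj @` S)) / ln n%:R).
Proof.
move=> S0 inv S1S S2S h1 h2 link.
have pS0 : proj @` S !=set0 by case: S0 => x Sx; exists (proj x), x.
have ln_max1 (w : nat) : ln (maxn 1 w)%:R = ln w%:R :> R.
  case: w => [|w]; last by rewrite (maxn_idPr _).
  by rewrite maxn0 ln1 [RHS]ln0.
apply: (@box_dim_of_words (fun k => maxn 1 #|words S1 k|)
  (fun l => maxn 1 #|words (proj @` S2) l|) (c.+1 * m ^ c)) => //.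
- by move=> k; rewrite leq_maxl.
- by move=> k; rewrite leq_maxl.
- rewrite -h1; under eq_fun do rewrite ln_max1.
  exact: entropy_linear_growth.
- rewrite -h2; under eq_fun do rewrite ln_max1.
  exact: entropy_linear_growth.
move=> k l.
have K1 : (1 <= c.+1 * m ^ c)%N by rewrite muln_gt0 expn_gt0 m0.
have leK p : (p <= #|squares S k (k + l)|)%N ->
    (p <= c.+1 * m ^ c * #|squares S k (k + l)|)%N.
  by move=> h; rewrite (leq_trans h)// leq_pmull.
have w1 := card_words_gt0 k S0; have w2 := card_words_gt0 l pS0.
have [->|a0] := posnP #|words S1 k|.
  rewrite maxn0 mul1n; apply: leK.
  apply: leq_trans (card_proj_words_le_squares k inv (leq_addl k l)).
  by rewrite geq_max w2 card_words_sub//; exact: image_subset.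
have [->|b0] := posnP #|words (proj @` S2) l|.
  rewrite maxn0 muln1; apply: leK.
  apply: leq_trans (card_words_le_squares k (k + l) inv).
  by rewrite geq_max w1 card_words_sub.
rewrite (maxn_idPr a0) (maxn_idPr b0).
apply: (leq_trans (card_linked_words l (fun x y p q => link x y k p q))).
rewrite -mulnA leq_mul2l /= mulnC.
exact: card_squaresDr.
Qed.

End dimension.

Theorem corollary3p1 (R : realType) (m n : nat) (hm : (2 <= m)%N)
    (hmn : (m < n)%N) (Sigma : set (nat -> digit m n)) (G : lgraph (digit m n)) :
  Sigma !=set0 -> is_sofic Sigma -> presents G Sigma ->
  ((exists H : subgraph G,
      [/\ component H, is_source H &
          entropy R (component_shift H) = entropy R Sigma])
   \/
   (exists H : subgraph G,
      [/\ component H, is_sink H &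
          entropy R (@proj_seq m n @` component_shift H)
          = entropy R (@proj_seq m n @` Sigma)])) ->
  has_box_dim (@coding_map R m n @` Sigma)
    (entropy R (@proj_seq m n @` Sigma) / ln m%:R
     + (entropy R Sigma - entropy R (@proj_seq m n @` Sigma)) / ln n%:R).
Proof.
move=> S0 _ SG.
have inv : shift_invariant Sigma by rewrite SG; exact: label_sequences_shift.
have sub (E : {set edge G}) : label_sequences E `<=` Sigma.
  by rewrite SG; exact/sub_label_sequences/finset.subsetT.
case=> -[H [Hc Hend Hh]].
- apply: (box_dim_of_linked hm hmn (S1 := component_shift H) (S2 := Sigma)
    (c := #|vertex G|)) => // [|x y k p q Sx].
    exact: sub.
  rewrite SG; apply: link_sequences (Sx) => e1 e2 e1H _.
  exact: source_has_path Hc Hend e1H.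
- apply: (box_dim_of_linked hm hmn (S1 := Sigma) (S2 := component_shift H)
    (c := #|vertex G|)) => // [|x y k p q].
    exact: sub.
  rewrite SG => Sx Sy; apply: link_sequences Sx Sy => e1 e2 _ e2H.
  exact: sink_has_path Hc Hend e2H.
Qed.
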